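(* Let $T$ be a set-sequential tree with at least 3 vertices, and let $u$ and $v$ be two distinct vertices of $T$ of degree 1. Take 4 disjoint copies $T_1, T_2, T_3, T_4$ of $T$, and for $1 \leq i \leq 4$ let $u_i$ and $v_i$ be the vertices of $T_i$ corresponding to $u$ and $v$ respectively. Let $T'$ be the tree obtained from the disjoint union $T_1 \cup T_2 \cup T_3 \cup T_4$ by adding the three edges $u_1u_2$, $v_2v_3$ and $u_3u_4$. Then $T'$ is set-sequential.
   Context: A graph $G$ is set-sequential if, for some positive integer $m$, there is an assignment of distinct nonzero vectors of $\mathbb{F}_2^m$ to the vertices of $G$ such that, when each edge is labeled with the sum (mod 2) of the labels of its two endpoints, every nonzero vector of $\mathbb{F}_2^m$ occurs exactly once among all vertex labels and edge labels. *)

(* Defs.v *)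
From mathcomp Require Import all_boot all_order all_algebra.
Set Implicit Arguments.
Unset Strict Implicit.
Unset Printing Implicit Defensive.
Import GRing.Theory.

Record sgraph := SGraph {
  vertex :> finType;
  adj : rel vertex;
  adj_sym : symmetric adj;
  adj_irrefl : irreflexive adj }.

Section Graphs.
Variable G : sgraph.

Definition edges : {set {set G}} := [set [set x; y] | x in G, y in G & adj x y].

Definition degree (x : G) : nat := #|[set y | adj x y]|.

Definition connected : Prop :=
  0 < #|G| /\ forall x y : G, connect (@adj G) x y.

(* The size bound excludes the length-2 closed walks x, y, x, which [ucycle]
   accepts because the relation is symmetric. *)
Definition acyclic : Prop :=
  forall c : seq G, 2 < size c -> ~ ucycle (@adj G) c.

Definition is_tree : Prop := connected /\ acyclic.

(* An edge is a two-element set of vertices, so summing the labels over it adds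
   the labels of its two endpoints. *)
Definition edge_label (m : nat) (f : G -> 'rV['F_2]_m) (E : {set G}) :
  'rV['F_2]_m := (\sum_(x in E) f x)%R.

Definition set_sequential : Prop :=
  exists m : nat, 0 < m /\
  exists f : G -> 'rV['F_2]_m,
    [/\ injective f,
        (forall x, f x <> 0%R) &
        forall w : 'rV['F_2]_m, w <> 0%R ->
          #|[set x : G | f x == w]|
            + #|[set E in edges | edge_label f E == w]| = 1].

End Graphs.

Section FourCopies.
Variables (T : sgraph) (u v : T).

Definition copy1 : 'I_4 := @Ordinal 4 0 isT.
Definition copy2 : 'I_4 := @Ordinal 4 1 isT.
Definition copy3 : 'I_4 := @Ordinal 4 2 isT.
Definition copy4 : 'I_4 := @Ordinal 4 3 isT.

(* The vertex (i, x) is the vertex of the i-th copy corresponding to x. *)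
Definition joining_edges : seq (('I_4 * T) * ('I_4 * T)) :=
  [:: ((copy1, u), (copy2, u));
      ((copy2, v), (copy3, v));
      ((copy3, u), (copy4, u))].

Definition four_copies_adj : rel ('I_4 * T) := fun p q =>
  [|| (p.1 == q.1) && adj p.2 q.2,
      (p, q) \in joining_edges | (q, p) \in joining_edges].

Lemma four_copies_sym : symmetric four_copies_adj.
Proof.
move=> p q; rewrite /four_copies_adj eq_sym adj_sym; congr (_ || _).
exact: orbC.
Qed.

Lemma four_copies_irrefl : irreflexive four_copies_adj.
Proof.
move=> [i x]; rewrite /four_copies_adj /= eqxx adj_irrefl /= orbb.
by rewrite !inE !xpair_eqE; case: i => -[|[|[|[|i]]]] Hi; rewrite //= ?andbF.
Qed.

Definition four_copies : sgraph := SGraph four_copies_sym four_copies_irrefl.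

End FourCopies.

(* Main.v *)
(** Label the vertex x of the i-th copy by (f x, w^(c x) a_i) in F_2^m x F_4, where
    f labels T, a_1, ..., a_4 = 0, 1, w, w^2 and c is a proper 3-colouring of T.
    Since w^k + w^l is invertible for k <> l mod 3, every vertex label and every
    edge label of T is lifted by the four copies in all four ways, and the three
    joining edges must carry the vectors (0, z) with z <> 0. For this, u has to be
    treated apart, as a_1 + a_2 = a_3 + a_4: exchange the first components of u and
    of its edge up (p the neighbour of u) in copies 3 and 4, and give the copies of u the second
    components 0, w, 1, w. If c p = 0 and c v = 1, the joining edges get w, 1, w^2.
    Such a c comes from a bipartition of T by recolouring v. *)
Require Import Defs.
From mathcomp Require Import all_boot all_order all_algebra.
Set Implicit Arguments.
Unset Strict Implicit.
Unset Printing Implicit Defensive.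
Import GRing.Theory.

Local Open Scope ring_scope.

(** * Vectors over the two-element field *)

Lemma addvv_F2 (m : nat) (x : 'rV['F_2]_m) : x + x = 0.
Proof.
apply/rowP=> j; rewrite !mxE.
by case: (x 0 j) => -[|[|[]]] // H; apply/val_inj.
Qed.

Lemma addvK_F2 (m : nat) (x y : 'rV['F_2]_m) : x + y + y = x.
Proof. by rewrite -addrA addvv_F2 addr0. Qed.

Lemma card_rV_F2 (m : nat) : #|{: 'rV['F_2]_m}| = (2 ^ m)%N.
Proof. by rewrite card_mx card_ord mul1n. Qed.

(** * Edge labels and counting of labels *)

Section Graphs.
Variable G : sgraph.
Implicit Types (x y : G) (S : {set G}).

Lemma edgesP (E : {set G}) :
  reflect (exists x y, adj x y /\ E = [set x; y]) (E \in edges G).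
Proof.
apply: (iffP imset2P) => [[x y _]|[x [y [xy ->]]]].
  by rewrite inE => /andP[_ xy] ->; exists x, y.
by exists x y => //; rewrite inE xy.
Qed.

Lemma mem_edges x y : adj x y -> [set x; y] \in edges G.
Proof. by move=> xy; apply/edgesP; exists x, y. Qed.

Lemma edge_label2 (m : nat) (f : G -> 'rV['F_2]_m) x y :
  adj x y -> edge_label f [set x; y] = f x + f y.
Proof.
move=> xy; rewrite /edge_label big_setU1 ?big_set1 //= inE.
by apply: contraTneq xy => ->; rewrite adj_irrefl.
Qed.

Definition label_count (m : nat) (f : G -> 'rV['F_2]_m) (w : 'rV['F_2]_m) : nat :=
  (#|[set x : G | f x == w]| + #|[set E in edges G | edge_label f E == w]|)%N.

Lemma sum_label_count (m : nat) (f : G -> 'rV['F_2]_m) :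
  (\sum_w label_count f w = #|G| + #|edges G|)%N.
Proof.
rewrite big_split /=; congr (_ + _)%N.
  rewrite -sum1_card (partition_big f predT) //=.
  by apply: eq_bigr => w _; rewrite -sum1_card; apply: eq_bigl => x; rewrite inE.
rewrite -sum1_card (partition_big (edge_label f) predT) //=.
by apply: eq_bigr => w _; rewrite -sum1_card; apply: eq_bigl => x; rewrite inE.
Qed.

Definition is_label (m : nat) (f : G -> 'rV['F_2]_m) (w : 'rV['F_2]_m) : Prop :=
  (exists x, f x = w) \/ (exists x y, adj x y /\ f x + f y = w).

Definition labels_onto (m : nat) (f : G -> 'rV['F_2]_m) : Prop :=
  forall w, w != 0 -> is_label f w.

Lemma label_count_gt0 (m : nat) (f : G -> 'rV['F_2]_m) w :
  (0 < label_count f w)%N <-> is_label f w.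
Proof.
rewrite addn_gt0; split.
  case/orP=> /card_gt0P[z]; rewrite inE; first by move/eqP; left; exists z.
  case/andP=> /edgesP[x [y [xy ->]]]; rewrite edge_label2 // => /eqP e.
  by right; exists x, y.
case=> [[x fx]|[x [y [xy fxy]]]]; apply/orP; [left|right]; apply/card_gt0P.
  by exists x; rewrite inE fx.
by exists [set x; y]; rewrite inE mem_edges // edge_label2 // fxy eqxx.
Qed.

(** Trades the exactly-once condition for surjectivity and a size bound, both easy to carry over to
    the four copies. The bound is strict because 0 is never a label: on an edge it would give both
    ends the same label. *)
Lemma set_sequential_labels : set_sequential G ->
  exists m (f : G -> 'rV['F_2]_m),
    [/\ (0 < m)%N, labels_onto f & (#|G| + #|edges G| < 2 ^ m)%N].
Proof.
case=> m [m0 [f [finj f0 fcount]]]; exists m, f; split=> //.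
  by move=> w /eqP w0; apply/label_count_gt0; rewrite /label_count fcount.
rewrite -(sum_label_count f) (bigD1 0) //=.
have -> : label_count f 0 = 0%N.
  apply/eqP; rewrite -leqn0 leqNgt; apply/negP => /label_count_gt0.
  case=> [[x /f0 //]|[x [y [xy fxy]]]].
  have /finj e : f x = f y by rewrite -[LHS](addvK_F2 _ (f y)) fxy add0r.
  by rewrite e adj_irrefl in xy.
rewrite add0n (eq_bigr (fun=> 1%N)); last by move=> w /eqP; apply: fcount.
by rewrite sum1_card (cardC1 0) card_rV_F2 prednK ?expn_gt0.
Qed.

(* With [#|G| + #|edges G|] at most the number of nonzero vectors, a labelling
   reaching all of them reaches each once and never takes the value 0. *)
Lemma labels_onto_set_sequential (m : nat) (f : G -> 'rV['F_2]_m) :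
  (0 < m)%N -> labels_onto f -> (#|G| + #|edges G| < 2 ^ m)%N ->
  set_sequential G.
Proof.
move=> m0 fonto lt.
have ge1 w : w != 0 -> (1 <= label_count f w)%N.
  by move=> w0; apply/label_count_gt0/fonto.
have tot : (\sum_(w : 'rV['F_2]_m) (w != 0)%R = (2 ^ m).-1)%N.
  rewrite -card_rV_F2 -(cardC1 0) -sum1_card [RHS]big_mkcond /=.
  by apply: eq_bigr => w _; rewrite inE; case: (_ == _).
(* The equality case of a termwise inequality: once the two sums agree, every count equals 1 off 0
   and vanishes at 0. *)
have [le eqc] : (\sum_(w : 'rV['F_2]_m) (w != 0)%R <= \sum_w label_count f w
    ?= iff [forall w, nat_of_bool (w != 0)%R == label_count f w])%N.
  apply: leqif_sum => w _; split=> //.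
  by case: (eqVneq w 0) => //= /ge1.
have {eqc} /forallP count1 : [forall w, nat_of_bool (w != 0)%R == label_count f w].
  rewrite -eqc eqn_leq le sum_label_count tot -ltnS prednK ?expn_gt0 //.
have f0 x : f x <> 0.
  move=> fx0; have := count1 0; rewrite eqxx eq_sym -leqn0 leqNgt => /negP; apply.
  by apply/label_count_gt0; left; exists x.
exists m; split=> //; exists f; split=> //; last first.
  by move=> w /eqP w0; have /eqP := count1 w; rewrite w0.
move=> x y fxy; have : (#|[set z | f z == f x]| <= 1)%N.
  apply: leq_trans (leq_addr #|[set E in edges G | edge_label f E == f x]| _) _.
  by have /eqP := count1 (f x); rewrite /label_count => <-; case: (_ != _).
by move/card_le1_eqP; apply; rewrite inE ?fxy.
Qed.

(** * Bipartitions of acyclic graphs, and leaves *)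

(* The first vertex of a longest path inside S: a second neighbour in S would
   lie on the path and close a cycle. *)
Lemma acyclic_low_degree S : acyclic G -> S != set0 ->
  exists2 x, x \in S & forall y z, y \in S -> z \in S -> adj x y -> adj x z -> y = z.
Proof.
move=> acyc /set0Pn[x0 x0S].
pose P n := [exists t : n.-tuple G,
  [&& uniq t, all (mem S) t & sorted (@adj G) t]].
have P1 : exists n, P n.
  by exists 1%N; apply/existsP; exists [tuple x0]; rewrite /= x0S.
have Pub n : P n -> (n <= #|G|)%N.
  by case/existsP=> t /and3P[/card_uniqP ut _ _]; rewrite -(size_tuple t) -ut max_card.
case: (ex_maxnP P1 Pub) => n /existsP[t /and3P[ut tS st]] nmax.
have n0 : (0 < n)%N.
  by apply: nmax; apply/existsP; exists [tuple x0]; rewrite /= x0S.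
case: t ut tS st => -[|x s] /= sz; first by rewrite -(eqP sz) in n0.
move=> us /andP[xS sS] path_s; exists x => //.
have nbr y : y \in S -> adj x y -> y = head x s.
  move=> yS xy.
  have ys : y \in x :: s.
    apply: contraT => ynotin.
    have : P n.+1; last by move/nmax; rewrite ltnn.
    apply/existsP; exists (@Tuple n.+1 _ (y :: x :: s) sz).
    by rewrite /= ynotin us yS xS sS path_s andbT adj_sym xy.
  move: ys; rewrite inE => /orP[/eqP e|ys]; first by rewrite e adj_irrefl in xy.
  case/splitPr: ys us sS path_s {sz} => -[|z s1] s2 //=.
  move=> us _ path_s; exfalso.
  apply: (acyc (x :: z :: rcons s1 y)); first by rewrite /= size_rcons.
  apply/andP; split.
    move: path_s => /=; rewrite -cat_rcons cat_path => /andP[xz /andP[p1 _]].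
    by rewrite xz /= rcons_path p1 last_rcons adj_sym.
  have : uniq ((x :: z :: rcons s1 y) ++ s2) by rewrite /= cat_rcons.
  by rewrite cat_uniq => /and3P[].
by move=> y z yS zS xy xz; rewrite (nbr y) // (nbr z).
Qed.

(** Induction on the size of a vertex set: remove a vertex with at most one neighbour in the set,
    colour the rest, and put it back. *)
Lemma acyclic_bipartite : acyclic G ->
  exists c : G -> bool, forall x y, adj x y -> c x != c y.
Proof.
move=> acyc.
suff: forall n S, #|S| = n -> exists c : G -> bool,
    {in S &, forall x y, adj x y -> c x != c y}.
  move=> /(_ _ [set: G] erefl)[c cP]; exists c => x y.
  by apply: cP; rewrite inE.
elim=> [|n IHn] S cardS.
  by move/eqP: cardS; rewrite cards_eq0 => /eqP ->; exists xpredT => x; rewrite inE.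
have S0 : S != set0 by rewrite -card_gt0 cardS.
have [x xS xP] := acyclic_low_degree acyc S0.
have /IHn[c cP] : #|S :\ x| = n by move: (cardsD1 x S); rewrite xS cardS => -[].
(* The colour opposite to that of the only possible neighbour of [x] in [S]; [false] if there is
   none. *)
pose d := [exists y in S, adj x y && ~~ c y].
have dP y : y \in S -> adj x y -> d != c y.
  move=> yS xy; rewrite /d; case cy: (c y).
    rewrite eqb_id; apply/negP => /exists_inP[z zS /andP[xz]].
    by rewrite -(xP _ _ yS zS xy xz) cy.
  by rewrite eqbF_neg negbK; apply/exists_inP; exists y => //; rewrite xy cy.
exists (fun y => if y == x then d else c y) => y z yS zS.
have [->|yx] := eqVneq y x; have [->|zx] := eqVneq z x.
- by rewrite adj_irrefl.
- exact: dP.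
- by rewrite adj_sym eq_sym; apply: dP.
by apply: cP; rewrite !inE ?yx ?zx.
Qed.

Lemma degree1_neighbor x : degree x = 1%N -> exists y, forall z, adj x z = (z == y).
Proof.
move/eqP/cards1P=> [y Ny]; exists y => z.
by move/setP/(_ z): Ny; rewrite !inE.
Qed.

(** Two adjacent leaves would form a whole component. Applied to u and v, this gives v different
    from p, so that the colours of p and v can be prescribed independently. *)
Lemma connected_leaves_nonadjacent x y : connected G -> (2 < #|G|)%N ->
  degree x = 1%N -> degree y = 1%N -> ~~ adj x y.
Proof.
move=> [_ conn] cardG /degree1_neighbor[x' xP] /degree1_neighbor[y' yP].
apply/negP=> xy; move: (xy) (xy); rewrite {1}xP adj_sym yP => /eqP e /eqP e'.
subst x' y'.
have cl : closed (@adj G) (mem [set x; y]).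
  move=> a b ab; rewrite !inE; apply/idP/idP.
    by case/orP=> /eqP e; move: ab; rewrite e ?xP ?yP => ->; rewrite ?orbT.
  by case/orP=> /eqP e; move: ab; rewrite adj_sym e ?xP ?yP => ->; rewrite ?orbT.
move: cardG; rewrite ltnNge => /negP; apply.
apply: leq_trans (_ : #|[set x; y]| <= 2)%N; last by rewrite cards2; case: (_ != _).
apply/subset_leq_card/subsetP=> z _.
by rewrite -(closed_connect cl (conn x z)) !inE eqxx.
Qed.

End Graphs.

(** * The four-element field as pairs of bits *)

Definition F4 : predArgType := (bool * bool)%type.

Definition F4_add (z w : F4) : F4 := (z.1 (+) w.1, z.2 (+) w.2).

(* Multiplication by w, for the basis 1, w of the four-element field. *)
Definition F4_mulw (z : F4) : F4 := (z.2, z.1 (+) z.2).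

Definition F4_vec (z : F4) : 'rV['F_2]_2 :=
  \row_j (if j == 0 then z.1 else z.2)%:R.

Lemma F4_vecD (z w : F4) : F4_vec (F4_add z w) = F4_vec z + F4_vec w.
Proof.
case: z w => [[] []] [[] []]; apply/rowP=> j; rewrite !mxE;
  by case: (_ == _); apply/val_inj.
Qed.

Lemma F4_vec0 : F4_vec (false, false) = 0.
Proof. by apply/rowP=> j; rewrite !mxE; case: (_ == _). Qed.

Lemma F4_vec_onto (w : 'rV['F_2]_2) : exists z, w = F4_vec z.
Proof.
exists (w 0 0 != 0, w 0 1 != 0); apply/rowP=> j; rewrite !mxE.
have bit (b : 'F_2) : b = (b != 0)%:R by case: b => -[|[|[]]] // H; apply/val_inj.
case: j => -[|[|[]]] // H /=; rewrite -bit; congr (w _ _); exact/val_inj.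
Qed.

(* The elements 0, 1, w, w^2, in this order. *)
Definition F4_of_ord (i : 'I_4) : F4 := (odd i, 1 < i)%N.

Lemma F4_of_ord_onto (z : F4) : exists i, F4_of_ord i = z.
Proof.
by case: z => [[] []]; [exists copy4|exists copy2|exists copy3|exists copy1].
Qed.

Lemma iter_mulw_onto (k : nat) (z : F4) :
  exists i, iter k F4_mulw (F4_of_ord i) = z.
Proof.
have [g _ gK] : bijective (iter k F4_mulw).
  elim: k => [|k IHk] /=; first by exists id.
  (* The inverse of multiplication by w is multiplication by w^2 = 1 + w. *)
  apply: (bij_comp _ IHk); exists (fun z => (z.1 (+) z.2, z.1)); by case=> [[] []].
by have [i iz] := F4_of_ord_onto (g z); exists i; rewrite iz gK.
Qed.

(* Distinct powers of w differ by a nonzero element. *)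
Lemma iter_mulw_add_onto (k l : 'I_3) (z : F4) : k != l ->
  exists i, F4_add (iter k F4_mulw (F4_of_ord i)) (iter l F4_mulw (F4_of_ord i)) = z.
Proof.
case: k l z => -[|[|[|//]]] Hk [[|[|[|//]]] Hl] [[] []] // _;
  first [by exists copy1 | by exists copy2 | by exists copy3 | by exists copy4].
Qed.

(** * The labelling of the four copies *)

Section FourCopiesLabelling.
Variables (T : sgraph) (u v p : T).
Hypothesis u_neq_v : u != v.
Hypothesis u_nbr : forall x, adj u x = (x == p).
Variable c : T -> 'I_3.
Hypothesis c_proper : forall x y, adj x y -> c x != c y.
Hypotheses (c_p : c p = 0%N :> nat) (c_v : c v = 1%N :> nat).
Variables (m : nat) (f : T -> 'rV['F_2]_m).
Hypothesis f_onto : labels_onto f.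

(** Indices start at 0, so [1 < i] selects copies 3 and 4. There u takes the first component of the
    edge up, and since p keeps [f p], that edge takes [f u]. *)
Definition four_copies_label (q : four_copies u v) : 'rV['F_2]_(m + 2) :=
  let: (i, x) := q in
  row_mx (if (x == u) && (1 < i)%N then f u + f p else f x)
    (F4_vec (if x == u then (i == 2 :> nat, odd i)
             else iter (c x) F4_mulw (F4_of_ord i))).

Lemma four_copies_labels_onto : labels_onto four_copies_label.
Proof.
have p_neq_u : (p == u) = false.
  by apply/eqP => e; have := adj_irrefl u; rewrite u_nbr e eqxx.
have up : adj u p by rewrite u_nbr.
have copy_adj i x y : adj x y -> @adj (four_copies u v) (i, x) (i, y).
  by move=> xy; rewrite /= /four_copies_adj /= eqxx xy.
have edge_u i : four_copies_label (i, u) + four_copies_label (i, p) =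
    row_mx (if (1 < i)%N then f u else f u + f p)
      (F4_vec (F4_add (i == 2 :> nat, odd i) (F4_of_ord i))).
  rewrite /four_copies_label eqxx p_neq_u /= c_p /= add_row_mx F4_vecD.
  by case: (1 < i)%N; rewrite ?addvK_F2.
move=> w; rewrite -[w]hsubmxK; move: (lsubmx w) (rsubmx w) => w1 w2 {w}.
have [z {w2}->] := F4_vec_onto w2.
(* Over [f u], the vertices u in copies 1, 2 give 0, w and the edges up in copies 3, 4 give w^2, 1.
   Over [f u + f p], the vertices in copies 3, 4 give 1, w and the edges in copies 1, 2 give 0,
   w^2. *)
have u_case : w1 = f u \/ w1 = f u + f p ->
    is_label four_copies_label (row_mx w1 (F4_vec z)).
  have V i w : four_copies_label (i, u) = w -> is_label four_copies_label w.
    by left; exists (i, u).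
  have E i w : four_copies_label (i, u) + four_copies_label (i, p) = w ->
      is_label four_copies_label w.
    by right; exists (i, u), (i, p); split=> //; apply: copy_adj.
  case=> ->; case: z => [[] []].
  - by apply: (E copy3); rewrite edge_u.
  - by apply: (E copy4); rewrite edge_u.
  - by apply: (V copy2); rewrite /four_copies_label eqxx.
  - by apply: (V copy1); rewrite /four_copies_label eqxx.
  - by apply: (E copy2); rewrite edge_u.
  - by apply: (V copy3); rewrite /four_copies_label eqxx.
  - by apply: (V copy4); rewrite /four_copies_label eqxx.
  - by apply: (E copy1); rewrite edge_u.
(* Both ends of a joining edge have the same first component, so its label has first component 0. *)
have [{u_case} ->|w1_neq0 _] := eqVneq w1 0.
  have v_neq_u : (v == u) = false by rewrite eq_sym (negbTE u_neq_v).
  have joinE q r : (q, r) \in joining_edges u v -> @adj (four_copies u v) q r.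
    by move=> qr; rewrite /= /four_copies_adj qr orbT.
  case: z => [[] []] nz; last by rewrite F4_vec0 row_mx0 eqxx in nz.
  - right; exists (copy3, u), (copy4, u); split; first by apply: joinE; rewrite !inE eqxx ?orbT.
    by rewrite /four_copies_label eqxx /= add_row_mx addvv_F2 -F4_vecD.
  - right; exists (copy2, v), (copy3, v); split; first by apply: joinE; rewrite !inE eqxx ?orbT.
    by rewrite /four_copies_label v_neq_u /= c_v /= add_row_mx addvv_F2 -F4_vecD.
  - right; exists (copy1, u), (copy2, u); split; first by apply: joinE; rewrite !inE eqxx ?orbT.
    by rewrite /four_copies_label eqxx /= add_row_mx addvv_F2 -F4_vecD.
have [[x fx]|[x [y [xy fxy]]]] := f_onto w1_neq0.
  have [xu|x_neq_u] := eqVneq x u; first by apply: u_case; left; rewrite -fx xu.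
  have [i iz] := iter_mulw_onto (c x) z.
  by left; exists (i, x); rewrite /four_copies_label (negbTE x_neq_u) /= fx iz.
have [xu|x_neq_u] := eqVneq x u.
  by move: xy; rewrite xu u_nbr => /eqP yp; apply: u_case; right; rewrite -fxy xu yp.
have [yu|y_neq_u] := eqVneq y u.
  move: xy; rewrite adj_sym yu u_nbr => /eqP xp; apply: u_case; right.
  by rewrite -fxy xp yu addrC.
have [i iz] := iter_mulw_add_onto z (c_proper xy).
right; exists (i, x), (i, y); split; first exact: copy_adj.
rewrite /four_copies_label (negbTE x_neq_u) (negbTE y_neq_u) /= add_row_mx.
by rewrite -F4_vecD iz fxy.
Qed.

End FourCopiesLabelling.

(** * Edge count and conclusion *)

Lemma card_four_copies_edges (T : sgraph) (u v : T) :
  (#|edges (four_copies u v)| <= 4 * #|edges T| + 3)%N.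
Proof.
pose A := [set [set (q.1, x) | x in q.2] | q : 'I_4 * {set T} in setX setT (edges T)].
pose B := [set [set (copy1, u); (copy2, u)]; [set (copy2, v); (copy3, v)];
           [set (copy3, u); (copy4, u)]].
have cardA : (#|A| <= 4 * #|edges T|)%N.
  by apply: leq_trans (leq_imset_card _ _) _; rewrite cardsX cardsT card_ord.
have cardB : (#|B| <= 3)%N.
  rewrite /B; apply: leq_trans (leq_card_setU _ _) _.
  by rewrite cards2 cards1; case: (_ != _).
apply: leq_trans (leq_add cardA cardB).
apply: leq_trans (leq_card_setU A B).
apply/subset_leq_card/subsetP => E /edgesP[[i x] [[j y] [xy ->]]].
move: xy; rewrite /= /four_copies_adj /= => /or3P[/andP[/eqP -> xy]|xy|xy].
- apply/setUP; left; apply/imsetP; exists (j, [set x; y]).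
    by rewrite !inE /= mem_edges.
  by rewrite /= imsetU1 imset_set1.
- apply/setUP; right; move: xy; rewrite !inE.
  by case/or3P=> /eqP[-> -> -> ->]; rewrite eqxx ?orbT.
- apply/setUP; right; move: xy; rewrite !inE setUC.
  by case/or3P=> /eqP[-> -> -> ->]; rewrite eqxx ?orbT.
Qed.

Local Close Scope ring_scope.

Theorem theorem17 (T : sgraph) (u v : T)
  (T_tree : is_tree T) (T_seq : set_sequential T) (T_card : 3 <= #|T|)
  (u_neq_v : u <> v) (u_leaf : degree u = 1) (v_leaf : degree v = 1) :
  set_sequential (four_copies u v).
Proof.
have [conn acyc] := T_tree.
have [p u_nbr] := degree1_neighbor u_leaf.
have v_neq_p : v != p.
  by rewrite -u_nbr connected_leaves_nonadjacent.
have [b b_proper] := acyclic_bipartite acyc.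
have [m [f [m_gt0 f_onto cardT]]] := set_sequential_labels T_seq.
(* The class of p gets 0 and v gets 1. If v lies in the class of p, its neighbours are in the other
   class, which must then avoid 0 and 1; otherwise v belongs to the other class, which can get 1
   throughout. *)
pose other : 'I_3 := if b v == b p then @Ordinal 3 2 isT else @Ordinal 3 1 isT.
pose c x : 'I_3 := if x == v then @Ordinal 3 1 isT
                   else if b x == b p then ord0 else other.
have c_proper x y : adj x y -> c x != c y.
  move=> xy; have := b_proper _ _ xy; rewrite /c /other.
  have [xv|_] := eqVneq x v; have [yv|_] := eqVneq y v; rewrite ?xv ?yv ?eqxx //;
  by case: (b v); case: (b p) => //; case: (b _) => //; case: (b _).
have c_p : c p = 0%N :> nat by rewrite /c eq_sym (negbTE v_neq_p) eqxx.
have c_v : c v = 1%N :> nat by rewrite /c eqxx.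
apply: (labels_onto_set_sequential (f := four_copies_label p c f)).
- by rewrite addn2.
- by apply: four_copies_labels_onto => //; apply/eqP.
have cardG : #|four_copies u v| = (4 * #|T|)%N by rewrite card_prod card_ord.
have := card_four_copies_edges u v.
rewrite cardG => cardE; rewrite expnD.
apply: leq_ltn_trans (leq_add (leqnn _) cardE) _.
(* With n the number of vertices and edges of [T], the goal 4n + 3 < 4 * 2^m reads 4(n + 1) <= 4 *
   2^m, which is n < 2^m. *)
rewrite addnA -mulnDr mulnC -addn1 -addnA -[(3 + 1)%N]/(1 * 4)%N -mulnDl leq_pmul2r //.
by rewrite addn1.
Qed.
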